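(* Run Step 1 of the two step algorithm (see context), and for $k=1,\dots,K$ let $\hat v_k\ge0$ satisfy $\hat v_k\sum_{i=1}^{n_k}\|M^{k(i)}\|_2\|N_{k(i)}\|_2=\|C^{0k}D_{0k}\|_F$. Suppose $\hat\theta_1\le|1-\hat v_k^2|\le\hat\theta_2$ for all $k$, with $0<\hat\theta_1\le\hat\theta_2$. Suppose also that all entries satisfy $\mu_1L\le|M_{(h,f)}|\le\mu_2L$ and $\mu_1L\le|N_{(h,f)}|\le\mu_2L$ for some $\mu_1\ge0$, $\mu_2\ge0$, $L\ge0$. Let $v_k$ with $0\le v_k\le1$ satisfy $v_k\sum_{i=1}^{n_k}\|M^{k(i)}\|_2\|N_{k(i)}\|_2=\|M^kN_k\|_F$, and let $0\le\theta_1\le\theta_2\le1$ be such that $\theta_1\le1-v_k^2\le\theta_2$ for all $k$. Let $0<\beta\le1$ and $$\widetilde\varphi=\frac{(\hat\theta_2-\hat\theta_1\beta+\theta_2\hat\theta_1\beta)^{1/2}}{(\hat\theta_2\hat\theta_1)^{1/4}}.$$ Let $\widetilde C,\widetilde D$ be the output of the two step algorithm applied in Step 2 with sampling probabilities satisfying $$p_{k_i}\ge\frac{\beta\|M^{k(i)}\|_2\|N_{k(i)}\|_2}{\sum_{i'=1}^{n_k}\|M^{k(i')}\|_2\|N_{k(i')}\|_2},\qquad k=1,\dots,K,\ i=1,\dots,n_k.$$ Then $$\sum_{h=1}^{m}\sum_{f=1}^{p}\sigma_{h,f}^2\le\frac{\widetilde\varphi^2}{\beta c}\|M\|_F^2\|N\|_F^2,$$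 and, for $\delta\in(0,1)$ and $\eta=\widetilde\varphi+\left(\frac{\hat\theta_2}{\hat\theta_1}\right)^{1/2}\sqrt{(8/\beta)\log(1/\delta)}$, the inequality $$\|MN-\widetilde C\widetilde D\|_F^2\le\frac{\eta^2}{\beta c}\|M\|_F^2\|N\|_F^2$$ holds with probability at least $1-\delta$ (over the sampling of Step 2, given the outcome of Step 1).
   Context: $M\in\mathbb{R}^{m\times n}$ and $N\in\mathbb{R}^{n\times p}$ are partitioned conformally as $M=[M^1\ \cdots\ M^K]$ with $M^k\in\mathbb{R}^{m\times n_k}$ and $N^T=[N_1^T\ \cdots\ N_K^T]$ with $N_k\in\mathbb{R}^{n_k\times p}$, $\sum_{k=1}^K n_k=n$. $M^{k(i)}$ is the $i$-th column of $M^k$, $N_{k(i)}$ the $i$-th row of $N_k$, $M^k_{(h,i)}$ and $N_{k(i,f)}$ the corresponding entries. $\|\cdot\|_2$ is the Euclidean norm, $\|\cdot\|_F$ the Frobenius norm. Basic sampling procedure. Given $A\in\mathbb{R}^{m\times r}$, $B\in\mathbb{R}^{r\times p}$, a number $s$ of samples and probabilities $q_1,\dots,q_r$ summing to $1$: draw $i_1,\dots,i_s\in\{1,\dots,r\}$ independently with replacement with $\Pr(i_t=j)=q_j$, and return the $m\times s$ matrix with $t$-th column $A^{(i_t)}/\sqrt{sq_{i_t}}$ and the $s\times p$ matrix with $t$-th row $B_{(i_t)}/\sqrt{sq_{i_t}}$, where $A^{(j)}$, $B_{(j)}$ are the $j$-th column of $A$ and $j$-th row of $B$. Two step algorithm.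 Input: $M,N$, positive integers $c$ and $c_0$, and probabilities $p_{0k_i}\ge0$ with $\sum_{i=1}^{n_k}p_{0k_i}=1$. Step 1: for each $k$, independently, apply the basic sampling procedure to $(M^k,N_k)$ with $[c_0/K]$ samples and probabilities $\{p_{0k_i}\}_{i=1}^{n_k}$ to obtain $(C^{0k},D_{0k})$, and set $$\widetilde c_k=c\,\frac{\Big|\big(\sum_{i=1}^{n_k}\|M^{k(i)}\|_2\|N_{k(i)}\|_2\big)^2-\|C^{0k}D_{0k}\|_F^2\Big|^{1/2}}{\sum_{l=1}^{K}\Big|\big(\sum_{i=1}^{n_l}\|M^{l(i)}\|_2\|N_{l(i)}\|_2\big)^2-\|C^{0l}D_{0l}\|_F^2\Big|^{1/2}}.$$ Step 2: for each $k$, independently across blocks and given Step 1, apply the basic sampling procedure to $(M^k,N_k)$ with $\widetilde c_k$ samples and probabilities $\{p_{k_i}\}_{i=1}^{n_k}$ (nonnegative, summing to $1$) to obtain $(\widetilde C^k,\widetilde D_k)$. Output $\widetilde C=[\widetilde C^1\ \cdots\ \widetilde C^K]$, $\widetilde D^T=[\widetilde D_1^T\ \cdots\ \widetilde D_K^T]$, $\widetilde C\widetilde D=\sum_{k=1}^{K}\widetilde C^k\widetilde D_k$. (The default choice is $p_{k_i}=\|M^{k(i)}\|_2\|N_{k(i)}\|_2/\sum_{i'}\|M^{k(i')}\|_2\|N_{k(i')}\|_2$; here the more general probabilities of the claim are used.) The asymptotic variance of the $(h,f)$ entry is $$\sigma_{h,f}^2=\sum_{k=1}^{K}\sum_{i=1}^{n_k}\frac{(M^k_{(h,i)})^2(N_{k(i,f)})^2}{\widetilde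 c_kp_{k_i}}-\sum_{k=1}^{K}\frac{((M^kN_k)_{(h,f)})^2}{\widetilde c_k},$$ with terms $0/0$ read as $0$. The numbers $\widetilde c_k$ are assumed to be positive integers, $[c_0/K]$ (the integer part) is assumed to be at least $1$, and all denominators in the formulas are assumed nonzero. *)

(* Defs.v *)
From HB Require Import structures.
From mathcomp Require Import all_boot all_order all_algebra.
From mathcomp Require Import all_classical all_reals all_analysis.
Set Implicit Arguments.
Unset Strict Implicit.
Unset Printing Implicit Defensive.
Import Order.TTheory GRing.Theory Num.Theory.
Local Open Scope ring_scope.

(* A matrix partitioned into K conformal blocks has its partitioned dimension
   written \sum_k n_ k; its blocks are then M^k := submxrow M k and
   N_k := submxcol N k. *)

(* On a row or a column vector this is the Euclidean norm; the library norm on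
   matrices is the sup norm. *)
Definition frobenius (R : realType) (m n : nat) (A : 'M[R]_(m, n)) : R :=
  Num.sqrt (\sum_i \sum_j A i j ^+ 2).

Definition is_distr (R : realType) (r : nat) (q : 'I_r -> R) : Prop :=
  (forall j, 0 <= q j) /\ \sum_j q j = 1.

(* Basic sampling procedure, as a function of the drawn indices w_1, ..., w_s. *)
Section BasicSampling.
Variables (R : realType) (m r p s : nat).
Variables (q : 'I_r -> R) (w : {ffun 'I_s -> 'I_r}).

Definition sample_cols (A : 'M[R]_(m, r)) : 'M[R]_(m, s) :=
  \matrix_(h, t) (A h (w t) / Num.sqrt (s%:R * q (w t))).

Definition sample_rows (B : 'M[R]_(r, p)) : 'M[R]_(s, p) :=
  \matrix_(t, f) (B (w t) f / Num.sqrt (s%:R * q (w t))).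

End BasicSampling.

(* An outcome of the draws in all K blocks, with [s k] draws from 'I_(n_ k) in
   block k. *)
Definition draws (K : nat) (n_ s : 'I_K -> nat) : finType :=
  {dffun forall k : 'I_K, {ffun 'I_(s k) -> 'I_(n_ k)}}.

(* Law of the draws: all draws are mutually independent, within a block and
   across blocks, and each draw of block k has law [q k]. *)
Definition draws_pr (R : realType) (K : nat) (n_ s : 'I_K -> nat)
    (q : forall k, 'I_(n_ k) -> R) (w : draws n_ s) : R :=
  \prod_k \prod_(t < s k) q k (w k t).

Definition Pr (R : realType) (K : nat) (n_ s : 'I_K -> nat)
    (q : forall k, 'I_(n_ k) -> R) (E : pred (draws n_ s)) : R :=
  \sum_(w | E w) draws_pr q w.

Section TwoStep.
Variables (R : realType) (m p K : nat) (n_ : 'I_K -> nat).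
Variables (M : 'M[R]_(m, \sum_k n_ k)) (N : 'M[R]_(\sum_k n_ k, p)).

Definition normprod (k : 'I_K) (i : 'I_(n_ k)) : R :=
  frobenius (col i (submxrow M k)) * frobenius (row i (submxcol N k)).

Definition block_weight (k : 'I_K) : R := \sum_i @normprod k i.

Section Step1.
Variables (c c0 : nat) (q0 : forall k, 'I_(n_ k) -> R).
Arguments q0 : clear implicits.
Variable w0 : draws n_ (fun=> (c0 %/ K)%N).

Definition step1_prod (k : 'I_K) : 'M[R]_(m, p) :=
  sample_cols (q0 k) (w0 k) (submxrow M k) *m
  sample_rows (q0 k) (w0 k) (submxcol N k).

Definition step1_dev (k : 'I_K) : R :=
  Num.sqrt `| block_weight k ^+ 2 - frobenius (step1_prod k) ^+ 2 |.

Definition ctilde (k : 'I_K) : R :=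
  c%:R * step1_dev k / \sum_l step1_dev l.

End Step1.

(* [ct k] is the number of samples of block k in Step 2, as a natural number. *)
Section Step2.
Variables (ct : 'I_K -> nat) (q : forall k, 'I_(n_ k) -> R).
Arguments q : clear implicits.

Definition Ctilde (w : draws n_ ct) : 'M[R]_(m, \sum_k ct k) :=
  \mxrow_k sample_cols (q k) (w k) (submxrow M k).

Definition Dtilde (w : draws n_ ct) : 'M[R]_(\sum_k ct k, p) :=
  \mxcol_k sample_rows (q k) (w k) (submxcol N k).

(* The convention 0 / 0 = 0 is that of the library ([invr0]). *)
Definition sigma2 (h : 'I_m) (f : 'I_p) : R :=
  \sum_k \sum_(i < n_ k)
     (submxrow M k h i ^+ 2 * submxcol N k i f ^+ 2) / ((ct k)%:R * q k i)
  - \sum_k ((submxrow M k *m submxcol N k) h f) ^+ 2 / (ct k)%:R.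

End Step2.

End TwoStep.

(* Main.v *)
Require Import Defs.
From HB Require Import structures.
From mathcomp Require Import all_boot all_order all_algebra.
From mathcomp Require Import all_classical all_reals all_analysis.
From mathcomp Require Import ring lra.
Set Implicit Arguments.
Unset Strict Implicit.
Unset Printing Implicit Defensive.
Import Order.TTheory GRing.Theory Num.Theory.
Import numFieldNormedType.Exports.
Local Open Scope ring_scope.

(* Given Step 1, the error M N - C~ D~ is a sum of independent centered
   matrices, one per draw, so the expectation of its squared Frobenius norm is
   the sum of the sigma_{h,f}^2. With W_k the block weights, the lower bound on
   the probabilities gives
     sum sigma^2 <= (1 - beta + beta theta2) / beta * sum_k W_k^2 / c~_k,
   and c~_k is proportional to W_k |1 - vhat_k^2|^(1/2), whence
     sum_k W_k^2 / c~_k <= (thetahat2 / thetahat1)^(1/2) (sum_k W_k)^2 / c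
   with sum_k W_k <= |M|_F |N|_F by Cauchy-Schwarz.
   Changing one draw of block k moves the Frobenius norm of the error by at most
   2 W_k / (beta c~_k), so the bounded differences inequality controls the
   deviation of that norm above its mean. Its proof averages out the draws one
   at a time; the weak constant of the symmetrization form of Hoeffding's lemma
   is enough for the factor 8 / beta in eta. *)

(** * A Gaussian bound on the hyperbolic cosine *)

Lemma is_derive_ge0_le (R : realType) (f df : R -> R) (a b : R) : a <= b ->
  (forall x : R, is_derive x 1 f (df x)) ->
  (forall x, a < x -> 0 <= df x) -> f a <= f b.
Proof.
move=> ab fdf df0.
apply: (@ger0_derive1_ndecry R f a) => // [x|].
- by rewrite in_itv/= andbT => /df0; rewrite derive1E derive_val.
- apply: continuous_subspaceT => x.
  by apply/differentiable_continuous/derivable1_diffP.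
Qed.

(** By parity take [y] nonnegative. The derivative of $2\cosh z\,e^{-z^2/2}$ is $2(\sinh z-z\cosh
    z)e^{-z^2/2}$, which is nonpositive for $z>0$, and the value at 0 is 2. The proof uses the
    opposite function [g], which is nondecreasing. *)
Lemma cosh_le_expR_sqr (R : realType) (y : R) :
  expR y + expR (- y) <= 2 * expR (y ^+ 2 / 2).
Proof.
wlog y0 : y / 0 <= y.
  move=> H; case: (leP 0 y) => [/H //|/ltW yN].
  by have := H (- y); rewrite oppr_ge0 yN sqrrN opprK addrC => /(_ isT).
have sinh_ge0 (x : R) : 0 <= x -> 0 <= expR x - expR (- x).
  by move=> x0; rewrite subr_ge0 ler_expR; lra.
(* tanh x <= x *)
have sinh_le (x : R) : 0 <= x -> expR x - expR (- x) <= x * (expR x + expR (- x)).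
  move=> x0.
  pose f (z : R) := z * (expR z + expR (- z)) - (expR z - expR (- z)).
  suff : f 0 <= f x by rewrite /f mul0r oppr0 subrr subr0; lra.
  apply: (is_derive_ge0_le (df := fun z => z * (expR z - expR (- z)))) => //.
  - by move=> z; rewrite /f; apply: is_derive_eq; rewrite /GRing.scale /=; ring.
  - by move=> z z0; rewrite mulr_ge0 ?sinh_ge0 ?ltW.
pose g (z : R) := - ((expR z + expR (- z)) * expR (- (z ^+ 2 / 2))).
have : g 0 <= g y.
  apply: (is_derive_ge0_le (df := fun z =>
   (z * (expR z + expR (- z)) - (expR z - expR (- z))) * expR (- (z ^+ 2 / 2)))) => //.
  - by move=> z; rewrite /g; apply: is_derive_eq; rewrite /GRing.scale /=; field.
  - by move=> z z0; rewrite mulr_ge0 ?expR_ge0 // subr_ge0 sinh_le ?ltW.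
rewrite /g lerN2 expr0n/= mul0r oppr0 !expR0 mulr1 [expR (- (_ / _))]expRN.
by rewrite ler_pdivrMr ?expR_gt0.
Qed.

(** * Jensen's inequality and Hoeffding's lemma for a finite law *)

Section FiniteLaw.
Variables (R : realType) (T : finType) (q : T -> R).
Hypotheses (q_ge0 : forall i, 0 <= q i) (q_sum1 : \sum_i q i = 1).

(** The exponential lies above its tangent line at the mean [mu], and that line averages to
    [expR mu]. *)
Lemma jensen_expR (x : T -> R) :
  expR (\sum_i q i * x i) <= \sum_i q i * expR (x i).
Proof.
set mu := \sum_i _.
have -> : expR mu = \sum_i q i * (expR mu * (1 + (x i - mu))).
  under eq_bigr do rewrite mulrCA mulrDr mulr1 mulrBr.
  by rewrite -mulr_sumr big_split/= sumrB -mulr_suml q_sum1 mul1r subrr addr0 mulr1.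
apply: ler_sum => i _; apply: ler_wpM2l => //.
rewrite -[in leRHS](subrK mu (x i)) [in leRHS]addrC expRD.
by apply: ler_wpM2l; [exact: expR_ge0|exact: expR_ge1Dx].
Qed.

Lemma sum_law_le (x : T -> R) (a : R) :
  (forall i, x i <= a) -> \sum_i q i * x i <= a.
Proof.
move=> xa; rewrite -[leRHS]mul1r -q_sum1 mulr_suml.
by apply: ler_sum => i _; apply: ler_wpM2l.
Qed.

(* Symmetrization by an independent copy of [x] gives the exponent [a^2 / 2];
   the optimal one is [a^2 / 8]. *)
Lemma hoeffding (x : T -> R) (a : R) : (forall i j, `|x i - x j| <= a) ->
  \sum_i q i * expR (x i) <= expR (a ^+ 2 / 2) * expR (\sum_i q i * x i).
Proof.
move=> xa; set mu := \sum_i q i * x i.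
rewrite -ler_pdivrMr ?expR_gt0 // -expRN.
have E0 : 0 <= \sum_i q i * expR (x i).
  by apply: sumr_ge0 => i _; rewrite mulr_ge0 ?expR_ge0.
(* Jensen for [- x] replaces [expR (- mu)] by the mean of [expR (- x j)], where [j] is the
   independent copy. *)
have /(ler_wpM2l E0) := jensen_expR (fun i => - x i).
under [X in expR X]eq_bigr do rewrite mulrN.
rewrite sumrN => /le_trans; apply.
rewrite big_distrlr /=.
(* Doubling the double sum and exchanging [i] with [j] in one copy pairs each exponential with its
   inverse, ready for [cosh_le_expR_sqr]. *)
rewrite -(ler_pM2l (ltr0Sn _ 1)) mulr_natl mulr2n [X in _ + X]exchange_big /=.
rewrite -big_split/=.
under eq_bigr do rewrite -big_split/=.
under eq_bigr => i _ do under eq_bigr => j _ do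
  rewrite (mulrACA (q i)) (mulrACA (q j)) (mulrC (q j)) -!expRD -mulrDr -(opprB (x _) (x j)) -mulrA.
under eq_bigr do rewrite -mulr_sumr.
apply: sum_law_le => i; apply: sum_law_le => j.
apply: le_trans (cosh_le_expR_sqr _) _.
rewrite ler_pM2l // ler_expR ler_wpM2r ?invr_ge0 //.
by rewrite -real_normK ?num_real // lerXn2r ?nnegrE // (le_trans _ (xa i j)).
Qed.

End FiniteLaw.

(** * Finite product laws and the bounded differences inequality *)

Section Product.
Variables (R : realType) (J : finType) (T : J -> finType) (q : forall j, T j -> R).
Arguments q : clear implicits.
Hypotheses (q_ge0 : forall j i, 0 <= q j i) (q_sum1 : forall j, \sum_i q j i = 1).

Local Notation Omega := {dffun forall j, T j}.

Implicit Types (w : Omega) (f : Omega -> R) (c : J -> R) (s : seq J).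

Definition prodpr w : R := \prod_j q j (w j).

Definition esp f : R := \sum_w prodpr w * f w.

Definition resample w j (i : T j) : Omega := finfun (dfwith w j i).
Arguments resample w [j] i.

(** The conditional expectation of [f] given all coordinates other than [j], kept as a function on
    the whole product. *)
Definition average j f : Omega -> R := fun w => \sum_i q j i * f (resample w i).

Definition bounded_differences c f := forall j w w',
  (forall l, l != j -> w l = w' l) -> `|f w - f w'| <= c j.

Lemma prodpr_ge0 w : 0 <= prodpr w.
Proof. exact: prodr_ge0. Qed.

Lemma resample_in w j (i : T j) : resample w i j = i.
Proof. by rewrite ffunE dfwithin. Qed.

Lemma resample_out w j (i : T j) l : l != j -> resample w i l = w l.
Proof. by move=> lj; rewrite ffunE dfwithout // eq_sym. Qed.

Lemma resample_resample w j (i i' : T j) :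
  resample (resample w i) i' = resample w i'.
Proof.
apply/ffunP => l; case: (eqVneq l j) => [->|lj].
  by rewrite !resample_in.
by rewrite !resample_out.
Qed.

Lemma resample_id w j : resample w (w j) = w.
Proof.
apply/ffunP => l; case: (eqVneq l j) => [->|lj].
  by rewrite !resample_in.
by rewrite !resample_out.
Qed.

(** Cross-multiplied, since [q j (w j)] may vanish. *)
Lemma prodpr_resample w j (i : T j) :
  prodpr (resample w i) * q j (w j) = prodpr w * q j i.
Proof.
rewrite /prodpr (bigD1 j) //= [in RHS](bigD1 j) //= resample_in.
rewrite [LHS]mulrC mulrA mulrAC; congr (_ * _ * _).
by apply: eq_bigr => l lj; rewrite resample_out.
Qed.

(** Exchanging coordinate [j] of [w] with the fresh value [i] is an involution on pairs that
    preserves their joint weight. After reindexing, [f] no longer sees [i], which sums out to 1. *)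
Lemma esp_average j f : esp (average j f) = esp f.
Proof.
rewrite /esp /average.
under eq_bigr do rewrite mulr_sumr.
rewrite pair_big /=.
pose h (x : Omega * T j) := (resample x.1 x.2, x.1 j).
have hK : involutive h.
  by move=> [w i]; rewrite /h /= resample_resample resample_id resample_in.
rewrite (reindex_inj (inv_inj hK)) /=.
under eq_bigr do rewrite resample_resample resample_id mulrA prodpr_resample.
rewrite -(pair_big predT predT (fun w i => prodpr w * q j i * f w)) /=.
by apply: eq_bigr => w _; rewrite -mulr_suml -mulr_sumr q_sum1 mulr1.
Qed.

(** Distributivity factors the total mass into the masses of the coordinates. Passing through
    [fprod] and tagged values turns dependent functions into the plain ones that
    [bigA_distr_big_dep] expects. *)
Lemma sum_prodpr : \sum_w prodpr w = 1.
Proof.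
rewrite (reindex (@dffun_of_fprod _ T)); last exact/onW_bij/dffun_of_fprod_bij.
under eq_bigr do rewrite /prodpr.
pose F j : {ffun T j -> R} := [ffun i => q j i].
transitivity (\sum_(x : fprod T) \prod_(j in J) F j (x j)).
  by apply: eq_bigr => x _; apply: eq_bigr => j _; rewrite !ffunE.
rewrite big_fprod.
rewrite -(@bigA_distr_big_dep R 0 1 *%R +%R _ _ _ (fun j => untag 0 (F j))).
rewrite big1 // => j _; rewrite -(q_sum1 j).
rewrite -(big_tag (fun j => F j)).
by apply: eq_bigr => i _; rewrite ffunE.
Qed.

Lemma esp_cst (a : R) : esp (fun=> a) = a.
Proof. by rewrite /esp -mulr_suml sum_prodpr mul1r. Qed.

Lemma ler_esp f g : (forall w, f w <= g w) -> esp f <= esp g.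
Proof. by move=> fg; apply: ler_sum => w _; rewrite ler_wpM2l ?prodpr_ge0. Qed.

Lemma espZ (a : R) f : esp (fun w => a * f w) = a * esp f.
Proof. by rewrite /esp mulr_sumr; apply: eq_bigr => w _; rewrite mulrCA. Qed.

Lemma esp_sum (I : finType) (f : I -> Omega -> R) :
  esp (fun w => \sum_i f i w) = \sum_i esp (f i).
Proof.
by rewrite /esp exchange_big; apply: eq_bigr => w _; rewrite mulr_sumr.
Qed.

Lemma esp_coord j (g : T j -> R) : esp (fun w => g (w j)) = \sum_i q j i * g i.
Proof.
rewrite -(esp_average j) -[RHS]esp_cst; congr esp; apply/funext => w.
by apply: eq_bigr => i _; rewrite resample_in.
Qed.

(** A cross term with [l != j] vanishes already after averaging over coordinate [l] alone. *)
Lemma esp_sum_centered_sqr (g : forall j, T j -> R) :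
  (forall j, \sum_i q j i * g j i = 0) ->
  esp (fun w => (\sum_j g j (w j)) ^+ 2) = \sum_j \sum_i q j i * g j i ^+ 2.
Proof.
move=> g0.
transitivity (\sum_j \sum_l esp (fun w => g j (w j) * g l (w l))).
  under eq_bigr do rewrite -esp_sum; rewrite -esp_sum; congr esp.
  by apply/funext => w; rewrite expr2 big_distrlr.
apply: eq_bigr => j _; rewrite (bigD1 j) //= [X in _ + X]big1 ?addr0.
  exact: (esp_coord (fun i => g j i * g j i)).
move=> l lj; rewrite -(esp_average l) -[RHS]esp_cst; congr esp.
apply/funext => w; rewrite /average.
under eq_bigr do rewrite resample_in resample_out 1?eq_sym // mulrCA.
by rewrite -mulr_sumr g0 mulr0.
Qed.

(** The difference of the two sides is the variance of [f]. *)
Lemma sqr_esp_le f : esp f ^+ 2 <= esp (fun w => f w ^+ 2).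
Proof.
have : 0 <= esp (fun w => (f w - esp f) ^+ 2).
  by rewrite -(esp_cst 0); apply: ler_esp => w; rewrite sqr_ge0.
have -> : esp (fun w => (f w - esp f) ^+ 2) =
    esp (fun w => f w ^+ 2) - esp f ^+ 2; last by rewrite subr_ge0.
have -> : esp f ^+ 2 = 2 * esp f * esp f - esp (fun=> esp f ^+ 2).
  by rewrite esp_cst; ring.
rewrite -espZ /esp opprB addrA -big_split -sumrB /=.
by apply: eq_bigr => w _; ring.
Qed.

(** Giving both points the same value at [j] creates no new disagreement, so the bound survives
    inside the mean. *)
Lemma average_bounded_differences c f j :
  bounded_differences c f -> bounded_differences c (average j f).
Proof.
move=> cf l w w' ww'; rewrite /average -sumrB.
apply: le_trans (ler_norm_sum _ _ _) _.
under eq_bigr do rewrite -mulrBr normrM ger0_norm //.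
apply: (sum_law_le (q_ge0 (j := j))) => // i; apply: cf => k kl.
case: (eqVneq k j) => [->|kj]; first by rewrite !resample_in.
by rewrite !resample_out // ww'.
Qed.

Lemma foldr_average_bounded_differences c f s :
  bounded_differences c f -> bounded_differences c (foldr average f s).
Proof.
by move=> cf; elim: s => //= j s; exact: average_bounded_differences.
Qed.

(** Each averaging removes the dependence on one coordinate; once all are averaged, the function is
    constant, hence equal to its expectation. *)
Lemma foldr_average_indep f s w w' : (forall j, j \notin s -> w j = w' j) ->
  foldr average f s w = foldr average f s w'.
Proof.
elim: s w w' => [|j s IH] w w' ww' /=.
  by congr f; apply/ffunP => j; exact: ww'.
apply: eq_bigr => i _; congr (_ * _); apply: IH => l ls.
case: (eqVneq l j) => [->|lj]; first by rewrite !resample_in.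
by rewrite !resample_out // ww' // inE negb_or lj.
Qed.

Lemma esp_foldr_average f s : esp (foldr average f s) = esp f.
Proof. by elim: s => //= j s IH; rewrite esp_average. Qed.

Lemma foldr_average_enum f w : foldr average f (enum J) w = esp f.
Proof.
rewrite -(esp_foldr_average f (enum J)) -[LHS]esp_cst; congr esp.
by apply/funext => w'; apply: foldr_average_indep => j; rewrite mem_enum.
Qed.

(** This plays the role of the martingale argument. With the other coordinates frozen, [l] times the
    current average varies by at most [|l| * c j] in coordinate [j], so Hoeffding's lemma costs one
    factor [expR (l ^+ 2 / 2 * c j ^+ 2)]. *)
Lemma esp_expR_foldr c f (l : R) s : bounded_differences c f ->
  esp (fun w => expR (l * f w)) <=
  expR (l ^+ 2 / 2 * \sum_(j <- s) c j ^+ 2) *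
    esp (fun w => expR (l * foldr average f s w)).
Proof.
move=> cf; elim: s => [|j s IH] /=; first by rewrite big_nil mulr0 expR0 mul1r.
apply: le_trans IH _.
rewrite big_cons mulrDr addrC expRD -[leRHS]mulrA ler_wpM2l ?expR_ge0 //.
rewrite -espZ -(esp_average j); apply: ler_esp => w; rewrite /average.
set g := foldr _ _ _.
have := @hoeffding _ _ (q j) (q_ge0 (j := j)) (q_sum1 j)
  (fun i => l * g (resample w i)) (`|l| * c j).
have -> : (`|l| * c j) ^+ 2 / 2 = l ^+ 2 / 2 * c j ^+ 2.
  by rewrite exprMn real_normK ?num_real // mulrAC.
have -> : \sum_i q j i * (l * g (resample w i)) =
    l * \sum_i q j i * g (resample w i).
  by rewrite mulr_sumr; apply: eq_bigr => i _; rewrite mulrCA.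
apply => i i'; rewrite -mulrBr normrM ler_wpM2l //.
apply: (foldr_average_bounded_differences s cf) => k kj.
by rewrite !resample_out.
Qed.

Lemma mcdiarmid c f (t C : R) : bounded_differences c f ->
  \sum_j c j ^+ 2 <= C -> 0 < C -> 0 <= t ->
  \sum_(w | esp f + t <= f w) prodpr w <= expR (- (t ^+ 2 / (2 * C))).
Proof.
(* This [l] minimizes the Chernoff exponent [l ^+ 2 / 2 * C - l * t]. *)
move=> cf cC C0 t0; pose l := t / C.
have l0 : 0 <= l by rewrite divr_ge0 // ltW.
have Chernoff : \sum_(w | esp f + t <= f w) prodpr w <=
    expR (- (l * (esp f + t))) * esp (fun w => expR (l * f w)).
  rewrite -espZ big_mkcond; apply: ler_sum => w _.
  have Pw := prodpr_ge0 w; case: ifPn => [fw|_].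
    rewrite ler_peMr // -expRD -expR0 ler_expR addrC subr_ge0.
    exact: ler_wpM2l.
  by rewrite !mulr_ge0 // expR_ge0.
apply: le_trans Chernoff _.
have /= := esp_expR_foldr l (enum J) cf.
have -> : (fun w => expR (l * foldr average f (enum J) w)) =
    fun=> expR (l * esp f).
  by apply/funext => w; rewrite foldr_average_enum.
rewrite esp_cst big_enum /= => /(ler_wpM2l (expR_ge0 (- (l * (esp f + t))))).
move=> /le_trans; apply; rewrite -!expRD ler_expR.
have := ler_wpM2l (divr_ge0 (sqr_ge0 l) (ler0n _ 2)) cC.
have -> : l ^+ 2 / 2 * C = t ^+ 2 / (2 * C).
  by rewrite /l; field; rewrite gt_eqF.
have : l * t = 2 * (t ^+ 2 / (2 * C)) by rewrite /l; field; rewrite gt_eqF.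
by rewrite mulrDr; lra.
Qed.

End Product.

(** * The Cauchy-Schwarz inequality and the Frobenius norm *)

Lemma sum_cauchy_schwarz (R : realType) (I : finType) (a b : I -> R) :
  \sum_i a i * b i <=
  Num.sqrt (\sum_i a i ^+ 2) * Num.sqrt (\sum_i b i ^+ 2).
Proof.
have a0 : 0 <= \sum_i a i ^+ 2 by apply: sumr_ge0 => i _; rewrite sqr_ge0.
have b0 : 0 <= \sum_i b i ^+ 2 by apply: sumr_ge0 => i _; rewrite sqr_ge0.
apply: le_trans (ler_norm _) _.
rewrite -ler_sqr ?nnegrE ?mulr_ge0 ?sqrtr_ge0 //.
rewrite real_normK ?num_real // exprMn !sqr_sqrtr //.
(* Lagrange's identity: this double sum is twice the gap between the squares of the two sides. *)
have : 0 <= \sum_i \sum_j (a i * b j - a j * b i) ^+ 2.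
  by apply: sumr_ge0 => i _; apply: sumr_ge0 => j _; rewrite sqr_ge0.
have -> : \sum_i \sum_j (a i * b j - a j * b i) ^+ 2 = \sum_i \sum_j
    (a i ^+ 2 * b j ^+ 2 + b i ^+ 2 * a j ^+ 2 - 2 * (a i * b i) * (a j * b j)).
  by apply: eq_bigr => i _; apply: eq_bigr => j _; ring.
under eq_bigr do rewrite sumrB big_split /= -!mulr_sumr.
rewrite sumrB big_split /= -!mulr_suml -mulr_sumr.
by rewrite expr2; set S := \sum_i a i * b i; lra.
Qed.

Section Frobenius.
Variable R : realType.

Lemma frobenius_ge0 m n (A : 'M[R]_(m, n)) : 0 <= frobenius A.
Proof. exact: sqrtr_ge0. Qed.

Lemma sqr_frobenius m n (A : 'M[R]_(m, n)) :
  frobenius A ^+ 2 = \sum_i \sum_j A i j ^+ 2.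
Proof.
rewrite sqr_sqrtr //.
by apply: sumr_ge0 => i _; apply: sumr_ge0 => j _; rewrite sqr_ge0.
Qed.

Lemma frobeniusZ m n (a : R) (A : 'M[R]_(m, n)) :
  frobenius (a *: A) = `|a| * frobenius A.
Proof.
apply/eqP; rewrite -(@eqrXn2 _ 2) ?mulr_ge0 ?frobenius_ge0 //; apply/eqP.
rewrite exprMn real_normK ?num_real // !sqr_frobenius mulr_sumr.
by apply: eq_bigr => i _; rewrite mulr_sumr; apply: eq_bigr => j _; rewrite mxE exprMn.
Qed.

Lemma frobeniusN m n (A : 'M[R]_(m, n)) : frobenius (- A) = frobenius A.
Proof. by rewrite -scaleN1r frobeniusZ normrN1 mul1r. Qed.

Lemma frobeniusD m n (A B : 'M[R]_(m, n)) :
  frobenius (A + B) <= frobenius A + frobenius B.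
Proof.
rewrite -ler_sqr ?nnegrE ?addr_ge0 ?frobenius_ge0 // sqrrD !sqr_frobenius.
have := sum_cauchy_schwarz (fun x => A x.1 x.2) (fun x => B x.1 x.2).
rewrite -(pair_big predT predT (fun i j => A i j ^+ 2)) /=.
rewrite -(pair_big predT predT (fun i j => B i j ^+ 2)) /=.
rewrite -(pair_big predT predT (fun i j => A i j * B i j)) /=.
rewrite -!/(frobenius _) => AB.
under eq_bigr => i _ do under eq_bigr => j _ do
  rewrite mxE sqrrD -[_ * _ *+ 2]mulr_natl.
under eq_bigr do rewrite big_split big_split /= -mulr_sumr.
by rewrite big_split big_split /= -mulr_sumr; lra.
Qed.

Lemma frobeniusB m n (A B : 'M[R]_(m, n)) :
  `|frobenius A - frobenius B| <= frobenius (A - B).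
Proof.
have := frobeniusD (A - B) B; have := frobeniusD (B - A) A.
by rewrite !subrK -opprB frobeniusN ler_norml; lra.
Qed.

Lemma frobenius_mul_col_row m n (u : 'cV[R]_m) (v : 'rV[R]_n) :
  frobenius (u *m v) = frobenius u * frobenius v.
Proof.
apply/eqP; rewrite -(@eqrXn2 _ 2) ?mulr_ge0 ?frobenius_ge0 //; apply/eqP.
rewrite exprMn !sqr_frobenius big_ord1 mulr_suml.
apply: eq_bigr => i _; rewrite big_ord1 mulr_sumr.
by apply: eq_bigr => j _; rewrite mxE big_ord1 exprMn.
Qed.

Lemma sqr_frobenius_submxrow m K (n_ : 'I_K -> nat) (M : 'M[R]_(m, \sum_k n_ k)) :
  frobenius M ^+ 2 = \sum_k \sum_i frobenius (col i (submxrow M k)) ^+ 2.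
Proof.
under [RHS]eq_bigr do under eq_bigr do rewrite sqr_frobenius.
rewrite sqr_frobenius exchange_big /= [RHS]sig_big_dep /=.
rewrite (reindex _ tagnat.sig_bij_on) /=.
apply: eq_bigr => i _; apply: eq_bigr => h _.
by rewrite big_ord1 !mxE tagnat.sig2K.
Qed.

Lemma sqr_frobenius_submxcol p K (n_ : 'I_K -> nat) (N : 'M[R]_(\sum_k n_ k, p)) :
  frobenius N ^+ 2 = \sum_k \sum_i frobenius (row i (submxcol N k)) ^+ 2.
Proof.
under [RHS]eq_bigr do under eq_bigr do rewrite sqr_frobenius big_ord1.
rewrite sqr_frobenius [RHS]sig_big_dep /= (reindex _ tagnat.sig_bij_on) /=.
by apply: eq_bigr => i _; apply: eq_bigr => f _; rewrite !mxE tagnat.sig2K.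
Qed.

End Frobenius.

(** * Mean, variance and concentration of the sampling error of Step 2 *)

Section Sampling.
Variables (R : realType) (m p K : nat) (n_ : 'I_K -> nat).
Variables (M : 'M[R]_(m, \sum_k n_ k)) (N : 'M[R]_(\sum_k n_ k, p)).

Lemma normprod_ge0 k (i : 'I_(n_ k)) : 0 <= normprod M N i.
Proof. by rewrite mulr_ge0 ?frobenius_ge0. Qed.

Lemma block_weight_ge0 k : 0 <= block_weight M N k.
Proof. by apply: sumr_ge0 => i _; exact: normprod_ge0. Qed.

(** Cauchy-Schwarz is applied once, over all pairs of a block and a position in it. *)
Lemma sum_block_weight_le :
  \sum_k block_weight M N k <= frobenius M * frobenius N.
Proof.
rewrite -[frobenius M]ger0_norm ?frobenius_ge0 // -sqrtr_sqr.
rewrite -[frobenius N]ger0_norm ?frobenius_ge0 // -sqrtr_sqr.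
rewrite sqr_frobenius_submxrow sqr_frobenius_submxcol !sig_big_dep /=.
exact: sum_cauchy_schwarz.
Qed.

Definition rank1_term k (i : 'I_(n_ k)) : 'M[R]_(m, p) :=
  col i (submxrow M k) *m row i (submxcol N k).

Lemma rank1_termE k (i : 'I_(n_ k)) h f :
  rank1_term i h f = submxrow M k h i * submxcol N k i f.
Proof. by rewrite mxE big_ord1 !mxE. Qed.

Lemma frobenius_rank1_term k (i : 'I_(n_ k)) :
  frobenius (rank1_term i) = normprod M N i.
Proof. exact: frobenius_mul_col_row. Qed.

Lemma sum_rank1_term k : \sum_(i < n_ k) rank1_term i = submxrow M k *m submxcol N k.
Proof.
apply/matrixP => h f; rewrite summxE mxE.
by apply: eq_bigr => i _; rewrite rank1_termE.
Qed.

Variables (ct : 'I_K -> nat) (q : forall k, 'I_(n_ k) -> R) (beta : R).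
Arguments q : clear implicits.
Hypotheses (ct_gt0 : forall k, (0 < ct k)%N) (q_distr : forall k, is_distr (q k)).
Hypothesis beta_gt0 : 0 < beta.
Hypothesis weight_gt0 : forall k, 0 < block_weight M N k.
Hypothesis q_ge : forall k i, beta * normprod M N i / block_weight M N k <= q k i.

Lemma sigma2E h f : sigma2 M N ct q h f =
  \sum_k (\sum_(i < n_ k) rank1_term i h f ^+ 2 / q k i
          - (submxrow M k *m submxcol N k) h f ^+ 2) / (ct k)%:R.
Proof.
rewrite /sigma2 -sumrB; apply: eq_bigr => k _; rewrite mulrBl mulr_suml.
congr (_ - _); apply: eq_bigr => i _.
by rewrite rank1_termE exprMn invfM mulrA mulrAC.
Qed.

Lemma sum_sigma2E : \sum_h \sum_f sigma2 M N ct q h f =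
  \sum_k (\sum_(i < n_ k) normprod M N i ^+ 2 / q k i
          - frobenius (submxrow M k *m submxcol N k) ^+ 2) / (ct k)%:R.
Proof.
under eq_bigr do under eq_bigr do rewrite sigma2E.
under eq_bigr do rewrite exchange_big /=.
rewrite exchange_big /=; apply: eq_bigr => k _.
under eq_bigr do rewrite -mulr_suml sumrB exchange_big /=.
rewrite -mulr_suml sumrB -sqr_frobenius exchange_big /=; congr ((_ - _) / _).
apply: eq_bigr => i _; rewrite -frobenius_rank1_term sqr_frobenius mulr_suml.
by apply: eq_bigr => h _; rewrite mulr_suml.
Qed.

Let q_ge0 k i : 0 <= q k i. Proof. by have [/(_ i)] := q_distr k. Qed.
Let q_sum1 k : \sum_i q k i = 1. Proof. by have [] := q_distr k. Qed.

(** The lower bound on [q] forces [normprod] to vanish where [q] does. Indices that are never drawn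
    thus contribute nothing to the product, and the estimator is unbiased. *)
Lemma rank1_term_eq0 k (i : 'I_(n_ k)) : q k i = 0 -> rank1_term i = 0.
Proof.
move=> qi0.
have a0 : normprod M N i = 0.
  apply/eqP; rewrite eq_le normprod_ge0 andbT.
  have := q_ge i; rewrite qi0 pmulr_lle0 ?invr_gt0 //.
  by rewrite pmulr_rle0.
have := sqr_frobenius (rank1_term i); rewrite frobenius_rank1_term a0 expr0n /=.
move=> /esym/eqP; rewrite psumr_eq0; last first.
  by move=> h _; apply: sumr_ge0 => f _; rewrite sqr_ge0.
move=> /allP S0; apply/matrixP => h f; rewrite [RHS]mxE.
have := S0 h (mem_index_enum _); rewrite psumr_eq0; last first.
  by move=> l _; rewrite sqr_ge0.
by move=> /allP/(_ f (mem_index_enum _)); rewrite /= sqrf_eq0 => /eqP.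
Qed.

Lemma normprod_div_le k (i : 'I_(n_ k)) :
  normprod M N i / q k i <= block_weight M N k / beta.
Proof.
have [qi0|qi0] := eqVneq (q k i) 0.
  (* The quotient by 0 is 0 here, so only the sign of the right side matters. *)
  by rewrite qi0 invr0 mulr0 divr_ge0 ?block_weight_ge0 // ltW.
have qi_gt0 : 0 < q k i by rewrite lt0r qi0 q_ge0.
have := q_ge i.
rewrite ler_pdivrMr // ler_pdivrMr // mulrAC ler_pdivlMr //; lra.
Qed.

(* The contribution to [M *m N - Ctilde *m Dtilde] of one draw of [i] in block
   [k]; it has mean zero. *)
Definition draw_error k (i : 'I_(n_ k)) : 'M[R]_(m, p) :=
  (ct k)%:R^-1 *: (submxrow M k *m submxcol N k - (q k i)^-1 *: rank1_term i).

(** The exact product of block [k] is split evenly over its [ct k] draws, and the two square roots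
    of the sampling procedure multiply to [(ct k)%:R * q k i]. *)
Lemma sampling_error (w : draws n_ ct) :
  M *m N - Ctilde M q w *m Dtilde N q w =
  \sum_k \sum_(t < ct k) draw_error (w k t).
Proof.
rewrite -{1}(submxrowK M) -{1}(submxcolK N) !mul_mxrow_mxcol -sumrB.
apply: eq_bigr => k _; rewrite -scaler_sumr sumrB sumr_const card_ord scalerBr.
have ctk : (ct k)%:R != 0 :> R by rewrite pnatr_eq0 -lt0n.
rewrite -[_ *m _ *+ _]scaler_nat scalerA mulVf // scale1r; congr (_ - _).
apply/matrixP => h f; rewrite !mxE summxE mulr_sumr; apply: eq_bigr => t _.
have -> (a : R) (A : 'M[R]_(m, p)) : (a *: A) h f = a * A h f by rewrite mxE.
rewrite rank1_termE mxE [_ t f]mxE mulrACA -invfM -expr2 sqr_sqrtr ?mulr_ge0 //.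
by rewrite invfM; ring.
Qed.

Lemma sum_draw_error k : \sum_(i < n_ k) q k i *: draw_error i = 0.
Proof.
under eq_bigr do rewrite /draw_error scalerA mulrC -scalerA scalerBr scalerA.
rewrite -scaler_sumr sumrB -scaler_suml q_sum1 scale1r -sum_rank1_term -sumrB.
rewrite big1 ?scaler0 // => i _; have [qi0|qi0] := eqVneq (q k i) 0.
  by rewrite rank1_term_eq0 // scaler0 subrr.
by rewrite mulfV // scale1r subrr.
Qed.

(** Expand the square: the rank-one terms sum to the block product [P], so the cross term gives
    [-2 P^2] and the constant term [P^2]. *)
Lemma draw_error_variance k h f :
  \sum_(i < n_ k) q k i * draw_error i h f ^+ 2 = (ct k)%:R^-1 ^+ 2 *
    (\sum_(i < n_ k) rank1_term i h f ^+ 2 / q k i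
     - (submxrow M k *m submxcol N k) h f ^+ 2).
Proof.
set P := submxrow M k *m submxcol N k.
have -> : \sum_(i < n_ k) q k i * draw_error i h f ^+ 2 = (ct k)%:R^-1 ^+ 2 *
    (\sum_(i < n_ k) (P h f ^+ 2 * q k i - 2 * P h f * rank1_term i h f
      + rank1_term i h f ^+ 2 / q k i)).
  rewrite mulr_sumr; apply: eq_bigr => i _.
  have -> : draw_error i h f =
      (ct k)%:R^-1 * (P h f - (q k i)^-1 * rank1_term i h f).
    by rewrite /draw_error -/P; move: P (rank1_term i) => A B; rewrite !mxE.
  have ctk : (ct k)%:R != 0 :> R by rewrite pnatr_eq0 -lt0n.
  have [qi0|qi0] := eqVneq (q k i) 0; last by field; apply/andP.
  have -> : rank1_term i h f = 0 by rewrite rank1_term_eq0 // mxE.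
  by rewrite qi0; ring.
rewrite big_split sumrB /= -!mulr_sumr q_sum1 mulr1.
have -> : \sum_(i < n_ k) rank1_term i h f = P h f by rewrite -summxE sum_rank1_term.
by congr (_ * _); ring.
Qed.

(** The block product cancels, leaving two reweighted rank-one terms, each bounded by
    [normprod_div_le]. *)
Lemma draw_error_diff k (i i' : 'I_(n_ k)) :
  frobenius (draw_error i - draw_error i') <=
  2 * block_weight M N k / (beta * (ct k)%:R).
Proof.
have -> : draw_error i - draw_error i' = (ct k)%:R^-1 *:
    ((q k i')^-1 *: rank1_term i' + (- (q k i)^-1) *: rank1_term i).
  by rewrite -scalerBr opprB addrC addrA subrK scaleNr.
rewrite frobeniusZ ger0_norm ?invr_ge0 //.
have := frobeniusD ((q k i')^-1 *: rank1_term i') ((- (q k i)^-1) *: rank1_term i).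
rewrite !frobeniusZ normrN !ger0_norm ?invr_ge0 // !frobenius_rank1_term => H.
have -> : 2 * block_weight M N k / (beta * (ct k)%:R) =
    (ct k)%:R^-1 * (block_weight M N k / beta + block_weight M N k / beta).
  by rewrite invfM; ring.
rewrite ler_wpM2l ?invr_ge0 // (le_trans H) // lerD //.
  by rewrite mulrC normprod_div_le.
by rewrite mulrC normprod_div_le.
Qed.

(** Flattening to one coordinate per pair of a block and a draw makes the law of the draws a single
    product law, to which the results on [prodpr] apply. *)
Let J := {k : 'I_K & 'I_(ct k)}.
Let T (j : J) : finType := 'I_(n_ (tag j)).
Let qJ (j : J) : T j -> R := q (tag j).

Definition unflatten (x : {dffun forall j : J, T j}) : draws n_ ct :=
  [ffun k => [ffun t => x (Tagged (fun k => 'I_(ct k)) t)]].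

Lemma unflatten_bij : bijective unflatten.
Proof.
exists (fun w : draws n_ ct => finfun (fun j : J => w (tag j) (tagged j) : T j)).
  by move=> x; apply/ffunP => -[k t]; rewrite !ffunE.
by move=> w; apply/ffunP => k; apply/ffunP => t; rewrite !ffunE.
Qed.

Lemma Pr_unflatten (E : pred (draws n_ ct)) :
  Pr q E = \sum_(x | E (unflatten x)) prodpr qJ x.
Proof.
rewrite /Pr (reindex unflatten); last exact/onW_bij/unflatten_bij.
apply: eq_bigr => x _; rewrite /draws_pr sig_big_dep /=.
by apply: eq_bigr => -[k t] _; rewrite !ffunE.
Qed.

Let qJ_ge0 (j : J) (i : T j) : 0 <= qJ i. Proof. exact: q_ge0. Qed.
Let qJ_sum1 (j : J) : \sum_i qJ (j := j) i = 1. Proof. exact: q_sum1. Qed.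

Let err (x : {dffun forall j : J, T j}) : 'M[R]_(m, p) :=
  \sum_(j : J) draw_error (k := tag j) (x j).

Lemma sampling_error_unflatten x :
  M *m N - Ctilde M q (unflatten x) *m Dtilde N q (unflatten x) = err x.
Proof.
rewrite sampling_error sig_big_dep /=.
by apply: eq_bigr => -[k t] _; rewrite !ffunE.
Qed.

Lemma esp_sqr_frobenius_err :
  esp qJ (fun x => frobenius (err x) ^+ 2) = \sum_h \sum_f sigma2 M N ct q h f.
Proof.
have -> : (fun x => frobenius (err x) ^+ 2) =
    fun x => \sum_h \sum_f err x h f ^+ 2.
  by apply/funext => x; rewrite sqr_frobenius.
rewrite esp_sum; apply: eq_bigr => h _; rewrite esp_sum; apply: eq_bigr => f _.
have -> : (fun x => err x h f ^+ 2) =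
    fun x => (\sum_(j : J) draw_error (k := tag j) (x j) h f) ^+ 2.
  by apply/funext => x; rewrite summxE.
rewrite (esp_sum_centered_sqr qJ_sum1
  (g := fun (j : J) (i : T j) => draw_error (k := tag j) i h f)); last first.
  move=> j; transitivity ((\sum_i q (tag j) i *: draw_error i) h f).
    by rewrite summxE; apply: eq_bigr => i _; rewrite [RHS]mxE.
  by rewrite sum_draw_error mxE.
under eq_bigr do rewrite draw_error_variance.
rewrite -(sig_big_dep predT (fun=> predT) (fun k (_ : 'I_(ct k)) =>
  (ct k)%:R^-1 ^+ 2 * (\sum_(i < n_ k) rank1_term i h f ^+ 2 / q k i
     - (submxrow M k *m submxcol N k) h f ^+ 2))) /=.
rewrite sigma2E; apply: eq_bigr => k _.
have ctk : (ct k)%:R != 0 :> R by rewrite pnatr_eq0 -lt0n.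
(* The [ct k] equal draws turn the factor $1/\widetilde c_k^2$ into $1/\widetilde c_k$. *)
by rewrite sumr_const card_ord -[LHS]mulr_natl expr2 !mulrA mulfV // mul1r mulrC.
Qed.

Lemma err_bounded_differences :
  bounded_differences
    (fun j : J => 2 * block_weight M N (tag j) / (beta * (ct (tag j))%:R))
    (fun x => frobenius (err x)).
Proof.
move=> j x x' xx'; apply: le_trans (frobeniusB _ _) _.
rewrite /err -sumrB (bigD1 j) //= big1 ?addr0; first exact: draw_error_diff.
by move=> l lj; rewrite xx' // subrr.
Qed.

(** The norm of the error has mean at most the root of its mean square, which is the root of the
    summed variances. A deviation of [t] above that root is therefore also one above the mean. [C]
    dominates the sum of squared differences over all draws. *)
Lemma sampling_concentration (t C : R) : 0 <= t -> 0 < C ->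
  4 / beta ^+ 2 * \sum_k block_weight M N k ^+ 2 / (ct k)%:R <= C ->
  1 - expR (- (t ^+ 2 / (2 * C))) <=
  Pr q (fun w : draws n_ ct => frobenius (M *m N - Ctilde M q w *m Dtilde N q w) <=
    Num.sqrt (\sum_h \sum_f sigma2 M N ct q h f) + t).
Proof.
move=> t0 C0 WC; set E := (X in Pr _ X); rewrite Pr_unflatten.
rewrite lerBlDr -[leLHS](sum_prodpr qJ_sum1).
rewrite (bigID (fun x => E (unflatten x))) /= lerD2l.
have := mcdiarmid qJ_ge0 qJ_sum1 err_bounded_differences _ C0 t0.
have -> : \sum_(j : J) (2 * block_weight M N (tag j) /
     (beta * (ct (tag j))%:R)) ^+ 2 =
   4 / beta ^+ 2 * \sum_k block_weight M N k ^+ 2 / (ct k)%:R.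
  rewrite -(sig_big_dep predT (fun=> predT) (fun k (_ : 'I_(ct k)) =>
    (2 * block_weight M N k / (beta * (ct k)%:R)) ^+ 2)) /= mulr_sumr.
  apply: eq_bigr => k _; rewrite sumr_const card_ord -mulr_natl; field.
  by rewrite pnatr_eq0 -lt0n ct_gt0 gt_eqF.
move=> /(_ WC) tail; apply: le_trans tail.
rewrite big_mkcond [leRHS]big_mkcond; apply: ler_sum => x _.
have P0 := prodpr_ge0 qJ_ge0 x; case: ifPn => [|_]; last by case: ifP.
rewrite /E sampling_error_unflatten -ltNge => /ltW Ex; rewrite ifT //.
apply: le_trans Ex; rewrite lerD2r -esp_sqr_frobenius_err.
apply: le_trans (ler_norm _) _; rewrite -sqrtr_sqr ler_wsqrtr //.
exact: (sqr_esp_le qJ_ge0 qJ_sum1).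
Qed.

(** By [normprod_div_le], the first part of the variance of block [k] is at most $W_k^2/\beta$;
    subtracting $v_k^2W_k^2$ leaves the coefficient
    $1/\beta-v_k^2=(1-\beta+\beta(1-v_k^2))/\beta$. *)
Lemma sum_sigma2_le (v : 'I_K -> R) (theta : R) :
  (forall k, v k * block_weight M N k = frobenius (submxrow M k *m submxcol N k)) ->
  (forall k, 1 - v k ^+ 2 <= theta) ->
  \sum_h \sum_f sigma2 M N ct q h f <=
  (1 - beta + beta * theta) / beta * \sum_k block_weight M N k ^+ 2 / (ct k)%:R.
Proof.
move=> vW vtheta; rewrite sum_sigma2E mulr_sumr; apply: ler_sum => k _.
rewrite mulrA ler_wpM2r ?invr_ge0 // -vW exprMn.
apply: (@le_trans _ _ (block_weight M N k ^+ 2 / beta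
                       - v k ^+ 2 * block_weight M N k ^+ 2)).
  have -> : block_weight M N k ^+ 2 / beta =
      \sum_(i < n_ k) normprod M N i * (block_weight M N k / beta).
    by rewrite -mulr_suml expr2 mulrA.
  rewrite lerD2r.
  apply: ler_sum => i _; rewrite expr2 -mulrA ler_wpM2l ?normprod_ge0 //.
  exact: normprod_div_le.
have -> : block_weight M N k ^+ 2 / beta - v k ^+ 2 * block_weight M N k ^+ 2 =
    (1 - beta + beta * (1 - v k ^+ 2)) / beta * block_weight M N k ^+ 2.
  by field; rewrite gt_eqF.
have b0 := ltW beta_gt0.
by rewrite ler_wpM2r ?sqr_ge0 // ler_wpM2r ?invr_ge0 // lerD2l ler_wpM2l.
Qed.

End Sampling.

(** * The effect of the Step 1 sample sizes *)

Section SampleSizes.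
Variables (R : realType) (m p K : nat) (n_ : 'I_K -> nat).
Variables (M : 'M[R]_(m, \sum_k n_ k)) (N : 'M[R]_(\sum_k n_ k, p)).
Variables (c c0 : nat) (q0 : forall k, 'I_(n_ k) -> R).
Variable w0 : draws n_ (fun=> (c0 %/ K)%N).
Hypothesis c_gt0 : (0 < c)%N.
Hypothesis weight_gt0 : forall k, 0 < block_weight M N k.
Variables (vhat : 'I_K -> R) (thetahat1 thetahat2 : R).
Hypothesis vhatE : forall k,
  vhat k * block_weight M N k = frobenius (step1_prod M N q0 w0 k).
Hypothesis thetahat1_gt0 : 0 < thetahat1.
Hypothesis thetahat1_le : thetahat1 <= thetahat2.
Hypothesis vhat_le : forall k, thetahat1 <= `|1 - vhat k ^+ 2| <= thetahat2.

Lemma step1_devE k : step1_dev M N q0 w0 k =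
  block_weight M N k * Num.sqrt `|1 - vhat k ^+ 2|.
Proof.
rewrite /step1_dev -vhatE exprMn -{1}[_ ^+ 2]mul1r -mulrBl normrM.
rewrite [`|block_weight M N k ^+ 2|]ger0_norm ?sqr_ge0 //.
by rewrite sqrtrM // sqrtr_sqr (gtr0_norm (weight_gt0 k)) mulrC.
Qed.

(** One factor $W_k$ cancels in $W_k^2/\widetilde c_k$. Then [thetahat1] bounds from below the
    deviation left in the denominator, and [thetahat2] bounds the normalizing sum [S] from above. *)
Lemma sum_sqr_weight_ctilde_le :
  \sum_k block_weight M N k ^+ 2 / ctilde M N c q0 w0 k <=
  Num.sqrt (thetahat2 / thetahat1) * (frobenius M * frobenius N) ^+ 2 / c%:R.
Proof.
have c0' : 0 < c%:R :> R by rewrite ltr0n.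
set S := \sum_l step1_dev M N q0 w0 l.
set W := \sum_k block_weight M N k.
have W0 : 0 <= W by apply: sumr_ge0 => k _; rewrite ltW.
have s1 : 0 < Num.sqrt thetahat1 by rewrite sqrtr_gt0.
have SW : S <= Num.sqrt thetahat2 * W.
  rewrite mulr_sumr; apply: ler_sum => k _; rewrite step1_devE mulrC.
  rewrite ler_wpM2r ?(ltW (weight_gt0 k)) // ler_wsqrtr //.
  by have /andP[] := vhat_le k.
have S0 : 0 <= S by apply: sumr_ge0 => k _; rewrite sqrtr_ge0.
have bound k : block_weight M N k ^+ 2 / ctilde M N c q0 w0 k <=
    block_weight M N k * (S / (Num.sqrt thetahat1 * c%:R)).
  set Wk := block_weight M N k; have Wk0 : 0 < Wk by exact: weight_gt0.
  set d := Num.sqrt `|1 - vhat k ^+ 2|.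
  have d1 : Num.sqrt thetahat1 <= d.
    by rewrite ler_wsqrtr //; have /andP[] := vhat_le k.
  have d0 : 0 < d by exact: lt_le_trans d1.
  have -> : Wk ^+ 2 / ctilde M N c q0 w0 k = Wk * (S / (d * c%:R)).
    rewrite /ctilde -/S step1_devE -/Wk -/d invf_div; field.
    by rewrite !gt_eqF.
  rewrite ler_wpM2l ?(ltW Wk0) // ler_wpM2l // lef_pV2 ?posrE ?mulr_gt0 //.
  by rewrite ler_pM2r.
apply: (@le_trans _ _
    (\sum_k block_weight M N k * (S / (Num.sqrt thetahat1 * c%:R)))).
  by apply: ler_sum => k _; exact: bound.
rewrite -mulr_suml -/W sqrtrM ?(le_trans (ltW thetahat1_gt0)) // sqrtrV ?(ltW thetahat1_gt0) //.
have den_ge0 : 0 <= (Num.sqrt thetahat1 * c%:R)^-1.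
  by rewrite invr_ge0 mulr_ge0 // ltW.
apply: le_trans (ler_wpM2l W0 (ler_wpM2r den_ge0 SW)) _.
have -> : W * (Num.sqrt thetahat2 * W / (Num.sqrt thetahat1 * c%:R)) =
    Num.sqrt thetahat2 / (Num.sqrt thetahat1 * c%:R) * W ^+ 2 by ring.
have -> (a : R) : Num.sqrt thetahat2 / Num.sqrt thetahat1 * a / c%:R =
    Num.sqrt thetahat2 / (Num.sqrt thetahat1 * c%:R) * a.
  by rewrite invfM; ring.
rewrite ler_wpM2l ?mulr_ge0 ?sqrtr_ge0 //.
rewrite lerXn2r ?nnegrE ?mulr_ge0 ?frobenius_ge0 //.
exact: sum_block_weight_le.
Qed.

End SampleSizes.

(** * Assembly of the variance bound and the probability bound *)

Theorem theorem8 (R : realType) (m p K : nat) (n_ : 'I_K -> nat)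
  (M : 'M[R]_(m, \sum_k n_ k)) (N : 'M[R]_(\sum_k n_ k, p))
  (c c0 : nat) (hc : (0 < c)%N) (hc0 : (0 < c0)%N) (hc0K : (1 <= c0 %/ K)%N)
  (* Step 1: probabilities, and an outcome w0 of the draws *)
  (q0 : forall k, 'I_(n_ k) -> R) (hq0 : forall k, is_distr (q0 k))
  (w0 : draws n_ (fun=> (c0 %/ K)%N)) (hw0 : 0 < draws_pr q0 w0)
  (* nonzero denominators; the sample sizes of Step 2 are positive integers *)
  (hweight : forall k, block_weight M N k != 0)
  (hdev : \sum_l step1_dev M N q0 w0 l != 0)
  (ct : 'I_K -> nat) (hct0 : forall k, (0 < ct k)%N)
  (hct : forall k, (ct k)%:R = ctilde M N c q0 w0 k)
  (vhat : 'I_K -> R) (hvhat0 : forall k, 0 <= vhat k)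
  (hvhat : forall k,
     vhat k * block_weight M N k = frobenius (step1_prod M N q0 w0 k))
  (thetahat1 thetahat2 : R)
  (hthetahat : 0 < thetahat1 /\ thetahat1 <= thetahat2)
  (hvthetahat : forall k, thetahat1 <= `|1 - vhat k ^+ 2| <= thetahat2)
  (mu1 mu2 L : R) (hmu1 : 0 <= mu1) (hmu2 : 0 <= mu2) (hL : 0 <= L)
  (hM : forall h i, mu1 * L <= `|M h i| <= mu2 * L)
  (hN : forall i f, mu1 * L <= `|N i f| <= mu2 * L)
  (v : 'I_K -> R) (hv01 : forall k, 0 <= v k <= 1)
  (hv : forall k,
     v k * block_weight M N k = frobenius (submxrow M k *m submxcol N k))
  (theta1 theta2 : R)
  (htheta : [/\ 0 <= theta1, theta1 <= theta2 & theta2 <= 1])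
  (hvtheta : forall k, theta1 <= 1 - v k ^+ 2 <= theta2)
  (beta : R) (hbeta : 0 < beta <= 1)
  (phi : R)
  (hphi : phi =
     Num.sqrt (thetahat2 - thetahat1 * beta + theta2 * thetahat1 * beta)
     / (thetahat2 * thetahat1) `^ (4^-1))
  (* Step 2: probabilities *)
  (q : forall k, 'I_(n_ k) -> R) (hq : forall k, is_distr (q k))
  (hqbeta : forall k i,
     beta * normprod M N i / block_weight M N k <= q k i) :
  \sum_h \sum_f sigma2 M N ct q h f
    <= phi ^+ 2 / (beta * c%:R) * frobenius M ^+ 2 * frobenius N ^+ 2
  /\
  forall delta eta : R, 0 < delta < 1 ->
    eta = phi + Num.sqrt (thetahat2 / thetahat1)
                * Num.sqrt (8 / beta * ln (1 / delta)) ->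
    1 - delta <=
      Pr q (fun w : draws n_ ct =>
        frobenius (M *m N - Ctilde M q w *m Dtilde N q w) ^+ 2
          <= eta ^+ 2 / (beta * c%:R) * frobenius M ^+ 2 * frobenius N ^+ 2).

Proof.
have weight_gt0 k : 0 < block_weight M N k.
  by rewrite lt0r hweight block_weight_ge0.
case: hthetahat => th1 th12; case/andP: hbeta => b0 b1.
set Q := frobenius M * frobenius N.
have c_gt0 : 0 < c%:R :> R by rewrite ltr0n.
have bc_gt0 : 0 < beta * c%:R by rewrite mulr_gt0.
have Wct : \sum_k block_weight M N k ^+ 2 / (ct k)%:R <=
    Num.sqrt (thetahat2 / thetahat1) * Q ^+ 2 / c%:R.
  under eq_bigr do rewrite hct.
  exact: (sum_sqr_weight_ctilde_le hc weight_gt0 hvhat th1 th12 hvthetahat).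
have Q_gt0 : 0 < Q.
  have K_gt0 : (0 < K)%N.
    (* Division by 0 gives 0 on naturals, so [1 <= c0 %/ K] excludes [K = 0]. *)
    by case: (posnP K) => // K0; move: hc0K; rewrite K0 divn0.
  apply: lt_le_trans (sum_block_weight_le M N).
  rewrite (bigD1 (Ordinal K_gt0)) //= ltr_pwDl // sumr_ge0 // => k _.
  exact: block_weight_ge0.
have th2 : 0 < thetahat2 by exact: lt_le_trans th12.
set r := thetahat2 / thetahat1.
have r_ge1 : 1 <= r by rewrite ler_pdivlMr // mul1r.
have r_gt0 : 0 < r by rewrite (lt_le_trans ltr01).
(* [Wct] carries [Num.sqrt r], while the square of the deviation term of [eta] carries [r]; the loss
   is harmless as [r >= 1]. *)
have sqrt_r : Num.sqrt r <= r.
  rewrite -[leRHS](gtr0_norm r_gt0) -sqrtr_sqr ler_wsqrtr //.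
  by rewrite expr2 ler_peMl // ltW.
have phi_ge0 : 0 <= phi by rewrite hphi divr_ge0 ?sqrtr_ge0 ?powR_ge0.
have theta2_le1 : theta2 <= 1 by case: htheta.
have theta2_ge0 : 0 <= theta2 by case: htheta; lra.
(* The numerator of [phi ^+ 2] exceeds [(1 - beta + beta * theta2) * thetahat2] by [beta * (1 -
   theta2) * (thetahat2 - thetahat1)], and [thetahat2] over the root of [thetahat2 * thetahat1] is
   [Num.sqrt r]. *)
have phi2 : (1 - beta + beta * theta2) * Num.sqrt r <= phi ^+ 2.
  have th_gt0 : 0 < thetahat2 * thetahat1 by rewrite mulr_gt0.
  have num_ge0 : (1 - beta + beta * theta2) * thetahat2 <=
      thetahat2 - thetahat1 * beta + theta2 * thetahat1 * beta.
    rewrite -subr_ge0.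
    have -> : thetahat2 - thetahat1 * beta + theta2 * thetahat1 * beta
        - (1 - beta + beta * theta2) * thetahat2
      = beta * (1 - theta2) * (thetahat2 - thetahat1) by ring.
    by rewrite !mulr_ge0 ?subr_ge0 ?(ltW b0).
  have num0 : 0 <= (1 - beta + beta * theta2) * thetahat2.
    by rewrite mulr_ge0 ?(ltW th2) // addr_ge0 ?subr_ge0 ?mulr_ge0 ?(ltW b0).
  rewrite hphi exprMn sqr_sqrtr ?(le_trans num0) // exprVn.
  rewrite -powR_mulrn ?powR_ge0 // -powRrM.
  have -> : 4^-1 * 2 = 2^-1 :> R by field.
  rewrite powR12_sqrt ?(ltW th_gt0) // ler_pdivlMr ?sqrtr_gt0 //.
  rewrite -[leLHS]mulrA -sqrtrM ?(ltW r_gt0) //.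
  have -> : r * (thetahat2 * thetahat1) = thetahat2 ^+ 2.
    by rewrite /r; field; rewrite gt_eqF.
  by rewrite sqrtr_sqr gtr0_norm.
have var : \sum_h \sum_f sigma2 M N ct q h f <= phi ^+ 2 / (beta * c%:R) * Q ^+ 2.
  have vtheta k : 1 - v k ^+ 2 <= theta2 by have /andP[] := hvtheta k.
  apply: le_trans (sum_sigma2_le ct hq b0 weight_gt0 hqbeta hv vtheta) _.
  apply: le_trans (ler_wpM2l _ Wct) _.
    by rewrite divr_ge0 ?(ltW b0) //; nra.
  have -> : (1 - beta + beta * theta2) / beta * (Num.sqrt r * Q ^+ 2 / c%:R) =
      (1 - beta + beta * theta2) * Num.sqrt r / (beta * c%:R) * Q ^+ 2.
    by field; rewrite !gt_eqF.
  by rewrite ler_wpM2r ?sqr_ge0 // ler_wpM2r ?invr_ge0 ?(ltW bc_gt0).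
rewrite -mulrA -exprMn -/Q; split=> // delta eta /andP[d0 d1] etaE.
(* [t] is the deviation part of [eta], rescaled. The constant 8 is twice the 4 of the squared
   differences, so that [t ^+ 2 / (2 * C)] is exactly [ln (1 / delta)]. *)
set C := 4 / beta ^+ 2 * (r * Q ^+ 2 / c%:R).
set t := Num.sqrt r * Num.sqrt (8 / beta * ln (1 / delta)) * Q
         / Num.sqrt (beta * c%:R).
have C_gt0 : 0 < C.
  by rewrite /C mulr_gt0 ?divr_gt0 ?exprn_gt0 // mulr_gt0 // exprn_gt0.
have t_ge0 : 0 <= t by rewrite divr_ge0 ?mulr_ge0 ?sqrtr_ge0 // ltW.
have WC : 4 / beta ^+ 2 * \sum_k block_weight M N k ^+ 2 / (ct k)%:R <= C.
  rewrite ler_wpM2l ?divr_ge0 ?sqr_ge0 // (le_trans Wct) //.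
  by rewrite ler_wpM2r ?invr_ge0 // ler_wpM2r ?sqr_ge0.
have lnd_ge0 : 0 <= 8 / beta * ln (1 / delta).
  rewrite mulr_ge0 ?divr_ge0 ?(ltW b0) // ln_ge0 // ler_pdivlMr // mul1r.
  exact: ltW.
have bcE (a : R) : (a / Num.sqrt (beta * c%:R)) ^+ 2 = a ^+ 2 / (beta * c%:R).
  by rewrite exprMn exprVn sqr_sqrtr // ltW.
have tail : expR (- (t ^+ 2 / (2 * C))) = delta.
  have -> : t ^+ 2 / (2 * C) = ln (1 / delta).
    rewrite /t bcE 2!exprMn (sqr_sqrtr lnd_ge0) (sqr_sqrtr (ltW r_gt0)) /C; field.
    by rewrite !gt_eqF.
  by rewrite div1r lnV ?posrE // opprK lnK ?posrE.
have := sampling_concentration hct0 hq b0 weight_gt0 hqbeta t_ge0 C_gt0 WC.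
rewrite tail => /le_trans; apply; rewrite /Pr.
rewrite big_mkcond [leRHS]big_mkcond; apply: ler_sum => w _.
have Pw : 0 <= draws_pr q w.
  by apply: prodr_ge0 => k _; apply: prodr_ge0 => i _; case: (hq k).
case: ifPn => [err_le|_]; last by case: ifP.
rewrite ifT // -mulrA -exprMn -/Q.
have -> : eta ^+ 2 / (beta * c%:R) * Q ^+ 2 = (eta * Q / Num.sqrt (beta * c%:R)) ^+ 2.
  by rewrite bcE [(eta * Q) ^+ 2]exprMn mulrAC.
have eta_ge0 : 0 <= eta by rewrite etaE addr_ge0 ?mulr_ge0 ?sqrtr_ge0.
rewrite ler_sqr ?nnegrE ?frobenius_ge0 ?divr_ge0 ?mulr_ge0 ?sqrtr_ge0 ?(ltW Q_gt0) //.
apply: le_trans err_le _.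
(* The [phi] part of [eta] covers the root of the variance by [var]; the remainder is [t]. *)
have -> : eta * Q / Num.sqrt (beta * c%:R) = phi * Q / Num.sqrt (beta * c%:R) + t.
  by rewrite etaE /t /r; ring.
rewrite lerD2r -[leRHS]ger0_norm ?divr_ge0 ?mulr_ge0 ?sqrtr_ge0 ?(ltW Q_gt0) //.
by rewrite -sqrtr_sqr ler_wsqrtr // bcE [(phi * Q) ^+ 2]exprMn mulrAC.
Qed.
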